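(* Let $X_1,X_2,\dots$ be independent nonnegative random variables such that $X_2,X_3,\dots$ are i.i.d. with $p:=\mathbb{P}(X_k>0)\in(0,1]$ for $k\ge2$. Let $\mathfrak{X}_2,\mathfrak{X}_3,\dots$ be i.i.d., independent of $(X_k)$, with $\mathbb{P}(\mathfrak{X}_k\in U)=\mathbb{P}(X_k\in U\mid X_k>0)$ for Borel $U$, and set $\mathfrak{S}_k=\mathfrak{X}_2+\dots+\mathfrak{X}_{k+1}$ and $S_n=X_1+\dots+X_n$. For $k\ge1$ let $I_k=\inf\{x\ge0:\mathbb{P}(X_k\le x)>0\}$. Suppose $I_2=0$, and let $L>0$ be such that $\mathbb{P}(X_1+\mathfrak{X}_2\le L)>0$. Define $K^\ast=\sup\{k\ge1:\mathbb{P}(X_1+\mathfrak{S}_k\le L)>0\}$. Then: (1) if $K^\ast=\infty$, then for every $\delta>0$, $\lim_{n\to\infty}\mathbb{P}(X_1>I_1+\delta\mid S_n\le L)=0$; (2) if $K^\ast<\infty$, then for every $\delta>0$, $\lim_{n\to\infty}\mathbb{P}(X_1>I_1+\delta\mid S_n\le L)=\mathbb{P}(X_1>I_1+\delta\mid X_1+\mathfrak{S}_{K^\ast}\le L)$. *)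

(* Defs.v *)
From HB Require Import structures.
From mathcomp Require Import all_boot all_order all_algebra.
From mathcomp Require Import all_classical all_reals all_analysis.
Set Implicit Arguments. Unset Strict Implicit. Unset Printing Implicit Defensive.
Import Order.TTheory GRing.Theory Num.Theory.
Import numFieldNormedType.Exports.
Local Open Scope classical_set_scope.
Local Open Scope ring_scope.

(* Conditional probability P(A | B) = P(A ∩ B) / P(B) (real-valued).
   (When P(B) = 0 this is 0 by the convention x / 0 = 0; under the
   hypotheses of the theorem all conditioning events used have positive
   probability.) *)
Definition cprob d (T : measurableType d) (R : realType) (P : probability T R)
  (A B : set T) : R := fine (P (A `&` B)) / fine (P B).

Definition mutually_independent d (T : measurableType d) (R : realType)
  (P : probability T R) (I : eqType) (D : set I) (Y : I -> T -> R) : Prop :=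
  forall (J : seq I) (B : I -> set R),
    uniq J -> (forall i, i \in J -> D i) -> (forall i, measurable (B i)) ->
    P (\big[setI/setT]_(i <- J) (Y i @^-1` B i)) =
    (\prod_(i <- J) P (Y i @^-1` B i))%E.

Definition ess_lower d (T : measurableType d) (R : realType)
  (P : probability T R) (X : T -> R) : R :=
  inf [set x : R | 0 <= x /\ (0 < P [set t | (X t <= x)%R])%E].

Definition partial_sum (R : realType) T (X : nat -> T -> R) (n : nat) (t : T) : R :=
  \sum_(1 <= i < n.+1) X i t.

Definition frak_sum (R : realType) T (Xf : nat -> T -> R) (k : nat) (t : T) : R :=
  \sum_(2 <= i < k.+2) Xf i t.

(* Main.v *)
Require Import Defs.
From HB Require Import structures.
From mathcomp Require Import all_boot all_order all_algebra.
From mathcomp Require Import all_classical all_reals all_analysis.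
From mathcomp Require Import measurable_realfun ring lra.
Import Order.TTheory GRing.Theory Num.Theory.
Import numFieldNormedType.Exports.
Local Open Scope classical_set_scope.
Local Open Scope ring_scope.

Set Implicit Arguments.
Unset Strict Implicit.
Unset Printing Implicit Defensive.

(** Write the law of a step [X_k], [k >= 2], as an atom of mass [q] at [0] plus
    [p] times the law of [Xf]. Splitting the last step accordingly, the
    probabilities [M n k] that [X_1] lies in [A] and that [X_1] plus [n] steps
    [X] plus [k] steps [Xf] is at most [L] satisfy
    [M n.+1 k = q * M n k + p * M n k.+1], whence
    [M n 0 = \sum_i 'C(n, i) * q ^+ (n - i) * p ^+ i * M 0 i].
    If [K*] is finite then [q > 0] and [M 0 i = 0] for [i > K*], so the term
    [i = K*] dominates, both for this [A] and for [A = setT].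

    If [K*] is infinite, every interval []0, e]] carries mass of the step law.
    Raising one of the many small steps into [[s, r]] for a suitable [s > 0]
    costs only [r], and few steps can exceed [s], so that
    [P (X_2 + ... + X_n <= x) = O(1 / n) * P (X_2 + ... + X_n <= x + r)]:
    having [X_1] larger than necessary becomes infinitely unlikely. *)

(** * Measurability of level sets *)

Section measurable_levels.
Context d (T : measurableType d) (R : realType).
Implicit Types f : T -> R.

Lemma measurable_preim (f : T -> R) (U : set R) :
  measurable_fun setT f -> measurable U -> measurable (f @^-1` U).
Proof. by move=> mf mU; rewrite -[X in measurable X]setTI; exact: mf. Qed.

Lemma measurable_le f (c : R) :
  measurable_fun setT f -> measurable [set t | f t <= c].
Proof.
move=> mf; rewrite [X in measurable X](_ : _ = f @^-1` `]-oo, c]%classic).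
  exact: measurable_preim.
by apply/seteqP; split => t /=; rewrite in_itv.
Qed.

Lemma measurable_gt f (c : R) :
  measurable_fun setT f -> measurable [set t | c < f t].
Proof.
move=> mf; rewrite [X in measurable X](_ : _ = f @^-1` `]c, +oo[%classic).
  exact: measurable_preim.
by apply/seteqP; split => t /=; rewrite in_itv/= andbT.
Qed.

End measurable_levels.

(** * Real-valued probabilities and mixtures of joint laws *)

Section probability_facts.
Context d (T : measurableType d) (R : realType) (P : probability T R).
Implicit Types (A B : set T) (f W Y : T -> R).

Lemma prE A : measurable A -> P A = (fine (P A))%:E.
Proof. by move=> mA; rewrite fineK// fin_num_measure. Qed.

Lemma pr_ge0 A : 0 <= fine (P A).
Proof. exact/fine_ge0/measure_ge0. Qed.

Lemma le_pr A B : measurable A -> measurable B -> A `<=` B ->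
  fine (P A) <= fine (P B).
Proof.
move=> mA mB AB; rewrite fine_le ?fin_num_measure//.
by rewrite le_measure ?inE.
Qed.

Lemma pr_gt0 A : measurable A -> (0 < fine (P A)) = (0 < P A)%E.
Proof. by move=> mA; rewrite [in RHS]prE// lte_fin. Qed.

(** Both sides are finite measures of the half-plane [x.1 + x.2 <= c] in [R * R]: the law of
    [(W, Y)] on the trace of [P] on [B], and a combination of those of [(W, 0)] and [(W, Y')]. They
    agree on rectangles, a pi-system generating the product sigma-algebra, hence everywhere. The set
    [B] later carries the condition on [X 1]. *)
Lemma joint_law_mixture (B : set T) (W Y Y' : T -> R) (q p : {nonneg R}) :
  measurable B -> measurable_fun setT W -> measurable_fun setT Y ->
  measurable_fun setT Y' ->
  (forall U V : set R, measurable U -> measurable V ->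
    P (W @^-1` U `&` Y @^-1` V `&` B) =
    (q%:num%:E * P (W @^-1` U `&` cst (0%R : R) @^-1` V `&` B) +
     p%:num%:E * P (W @^-1` U `&` Y' @^-1` V `&` B))%E) ->
  forall c : R, P ([set t | (W t + Y t <= c)%R] `&` B) =
    (q%:num%:E * P ([set t | (W t <= c)%R] `&` B) +
     p%:num%:E * P ([set t | (W t + Y' t <= c)%R] `&` B))%E.
Proof.
move=> mB mW mY mY' rect c.
have m2 (Z : T -> R) : measurable_fun setT Z ->
    measurable_fun setT (fun t => (W t, Z t) : R * R).
  by move=> mZ; exact: measurable_fun_pair.
pose law Z (mZ : measurable_fun setT Z) : {measure set (R * R) -> \bar R} :=
  measure_function_pushforward__canonical__measure_function_Measure
    (mrestr P mB) (m2 _ mZ).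
pose m1 := law _ mY.
pose m3 : {measure set (R * R) -> \bar R} := measure_add
  (mscale q (law _ (measurable_cst (0%R : R)))) (mscale p (law _ mY')).
have m3E X : m3 X = (q%:num%:E * law _ (measurable_cst (0%R : R)) X +
    p%:num%:E * law _ mY' X)%E by exact: measure_addE.
pose G := [set A `*` U | A in (@measurable _ R) & U in (@measurable _ R)].
have mix E : measurable E -> m1 E = m3 E.
  apply: (@measure_unique _ R (R * R)%type G (fun=> setT)).
  - exact: measurable_prod_measurableType.
  - move=> _ _ [A1 mA1 [U1 mU1 <-]] [A2 mA2 [U2 mU2 <-]]; rewrite -setXI.
    by exists (A1 `&` A2); [exact: measurableI|exists (U1 `&` U2);
      [exact: measurableI|]].
  - by move=> _; exists setT => //; exists setT => //; rewrite setXTT.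
  - by rewrite bigcup_const//; exists 0%N.
  - move=> _ [U mU [V mV <-]]; rewrite m3E.
    exact: rect.
  - move=> _; rewrite (le_lt_trans _ (ltry 1))//.
    by apply: probability_le1; apply: measurableI => //; rewrite preimage_setT.
pose E := [set x : R * R | x.1 + x.2 <= c].
have mE : measurable E.
  rewrite /E; apply: (@measurable_le _ (R * R)%type R (fun x => x.1 + x.2)).
  apply: measurable_funD; [exact: measurable_fst|exact: measurable_snd].
have := mix _ mE; rewrite m3E.
have -> : [set t | W t <= c] = [set t | W t + cst (0 : R) t <= c].
  by apply/seteqP; split => t /=; rewrite addr0.
by [].
Qed.
End probability_facts.

(** * First-moment bounds by counting events *)

Section counting.
Context d (T : measurableType d) (R : realType) (P : probability T R).
Context (I : eqType) (l : seq I) (A : I -> set T) (E : set T).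
Hypotheses (mA : forall i, i \in l -> measurable (A i)) (mE : measurable E).

(** Measurable for every index, which the exchange of sum and integral asks for, and equal to [A] on
    [l]. *)
Let A' i := if i \in l then A i else set0.

Let mA' i : measurable (A' i).
Proof. by rewrite /A'; case: ifPn => // /mA. Qed.

Let sum_prE : (\sum_(i <- l) fine (P (A i `&` E)))%:E =
  (\int[P]_(t in E) (\sum_(i <- l) \1_(A i) t)%:E)%E.
Proof.
transitivity (\sum_(i <- l) \int[P]_(t in E) (\1_(A' i) t)%:E)%E.
  rewrite -sumEFin big_seq [RHS]big_seq; apply: eq_bigr => i il.
  rewrite integral_indic// /A' il -prE//; apply: measurableI => //; exact: mA.
rewrite -ge0_integral_sum//; last first.
  by move=> i; apply/measurable_EFinP; exact: measurable_indic.
apply: eq_integral => t _; rewrite sumEFin; congr (_%:E).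
by rewrite big_seq [RHS]big_seq; apply: eq_bigr => i il; rewrite /A' il.
Qed.

Let mcount : measurable_fun E (fun t => (\sum_(i <- l) \1_(A i) t : R)%:E).
Proof.
rewrite (_ : (fun _ => _) = fun t => (\sum_(i <- l) \1_(A' i) t : R)%:E).
  apply/measurable_EFinP; apply: measurable_sum => i.
  exact: measurable_indic.
apply/funext => t; congr (_%:E).
by rewrite big_seq [RHS]big_seq; apply: eq_bigr => i il; rewrite /A' il.
Qed.

Let count_ge0 t : 0 <= (\sum_(i <- l) \1_(A i) t : R).
Proof. by apply: sumr_ge0 => i _; rewrite indicE. Qed.

Lemma sum_pr_le (M : R) : 0 <= M ->
  (forall t, E t -> \sum_(i <- l) \1_(A i) t <= M) ->
  \sum_(i <- l) fine (P (A i `&` E)) <= M * fine (P E).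
Proof.
move=> M0 AM; rewrite -lee_fin sum_prE EFinM -prE// -integral_cst//.
apply: ge0_le_integral => //.
by move=> t _; rewrite lee_fin.
Qed.

Lemma sum_pr_ge (M : R) :
  (forall t, E t -> M <= \sum_(i <- l) \1_(A i) t) ->
  M * fine (P E) <= \sum_(i <- l) fine (P (A i `&` E)).
Proof.
move=> AM; have [M0|M0] := leP 0 M; last first.
  apply: (@le_trans _ _ 0); last by apply: sumr_ge0 => i _; exact: pr_ge0.
  by rewrite mulr_le0_ge0 ?pr_ge0// ltW.
rewrite -lee_fin sum_prE EFinM -prE// -integral_cst//.
by apply: ge0_le_integral.
Qed.
End counting.

(** * Independence of a variable from finite sums of others, and the switching bound *)

Section independence.
Context d (T : measurableType d) (R : realType) (P : probability T R).
Context (I : eqType) (D : set I) (Y : I -> T -> R).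
Hypothesis mY : forall i, D i -> measurable_fun setT (Y i).
Hypothesis indY : mutually_independent P D Y.

(** The pi-system generating the sigma-algebra of the variables [Y j], [j] in [J]. *)
Definition cylinder (J : seq I) : set (set T) :=
  [set E | exists B : I -> set R, (forall i, measurable (B i)) /\
     E = \big[setI/setT]_(i <- J) (Y i @^-1` B i)].

Lemma cylinderI J : setI_closed (cylinder J).
Proof.
move=> _ _ [A [mA ->]] [B [mB ->]]; exists (fun i => A i `&` B i).
by split=> [i|]; [exact: measurableI|rewrite -big_split].
Qed.

Lemma cylinderT J : cylinder J setT.
Proof.
by exists (fun=> setT); split=> //; rewrite big1.
Qed.

Lemma measurable_cylinder J : (forall i, i \in J -> D i) ->
  cylinder J `<=` measurable.
Proof.
move=> DJ _ [B [mB ->]]; rewrite big_seq; apply: bigsetI_measurable => i iJ.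
exact: measurable_preim (mY (DJ _ iJ)) (mB i).
Qed.

Lemma sigma_cylinder_indep (J : seq I) i (E : set T) (V : set R) :
  uniq (i :: J) -> (forall j, j \in i :: J -> D j) -> measurable V ->
  <<s cylinder J >> E -> P (E `&` Y i @^-1` V) = (P E * P (Y i @^-1` V))%E.
Proof.
move=> uJ DJ mV; have DJ' j : j \in J -> D j.
  by move=> jJ; apply: DJ; rewrite inE jJ orbT.
have mA : measurable (Y i @^-1` V).
  by apply: measurable_preim => //; apply/mY/DJ; rewrite mem_head.
pose m1 : {measure set T -> \bar R} := mrestr P mA.
pose c : {nonneg R} := NngNum (pr_ge0 P (Y i @^-1` V)).
pose m2 : {measure set T -> \bar R} := mscale c P.
have m2E X : m2 X = (P X * P (Y i @^-1` V))%E.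
  by rewrite muleC (prE P mA).
rewrite -m2E; move: E; apply: (@g_sigma_algebra_measure_unique _ _ _
    (cylinder J) (measurable_cylinder DJ') (fun=> setT) _ _ m1 m2).
- by move=> _; exact: cylinderT.
- by rewrite bigcup_const//; exists 0%N.
- exact: cylinderI.
- move=> _ [B [mB ->]]; rewrite m2E /m1.
  (* Setting the constraint at [i] to [V] leaves the cylinder over [J] unchanged, since [i] is not
     in [J]. *)
  pose B' j := if j == i then V else B j.
  have mB' j : measurable (B' j) by rewrite /B'; case: ifP.
  have B'E j : j \in J -> B' j = B j.
    move=> jJ; rewrite /B'; case: eqP => // ji.
    by move: uJ; rewrite /= -ji jJ.
  have := indY uJ DJ mB'; rewrite !big_cons /B' eqxx -/B'.
  have -> : \big[setI/setT]_(j <- J) (Y j @^-1` B' j) =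
      \big[setI/setT]_(j <- J) (Y j @^-1` B j).
    by rewrite big_seq [RHS]big_seq; apply: eq_bigr => j /B'E ->.
  have -> : (\prod_(j <- J) P (Y j @^-1` B' j) =
      \prod_(j <- J) P (Y j @^-1` B j))%E.
    by rewrite big_seq [RHS]big_seq; apply: eq_bigr => j /B'E ->.
  have uJ' : uniq J by case/andP: uJ.
  by rewrite -(indY uJ' DJ' mB) muleC setIC.
- move=> _; rewrite (le_lt_trans _ (ltry 1))//.
  by apply: probability_le1; apply: measurableI.
Qed.

Lemma sigma_cylinder_measurable_fun (J : seq I) j : j \in J -> uniq J ->
  measurable_fun setT (Y j : g_sigma_algebraType (cylinder J) -> R).
Proof.
move=> jJ uJ _ U mU; rewrite setTI; apply: sub_sigma_algebra.
exists (fun i => if i == j then U else setT); split=> [i|]; first by case: ifP.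
rewrite (bigD1_seq j)//= eqxx big1 ?setIT// => i /negbTE ->.
by rewrite preimage_setT.
Qed.

Definition family_sum (l : seq I) (t : T) : R := \sum_(j <- l) Y j t.

Lemma sigma_cylinder_measurable_sum (J l : seq I) : {subset l <= J} -> uniq J ->
  measurable_fun setT (family_sum l : g_sigma_algebraType (cylinder J) -> R).
Proof.
move=> lJ uJ; elim: l lJ => [|j l IH] lJ; rewrite /family_sum.
  by under eq_fun do rewrite big_nil; exact: measurable_cst.
under eq_fun do rewrite big_cons.
apply: measurable_funD.
  by apply: sigma_cylinder_measurable_fun => //; apply: lJ; rewrite mem_head.
by apply: IH => x xl; apply: lJ; rewrite inE xl orbT.
Qed.

Lemma family_sum_indep (l : seq I) i (U V : set R) :
  uniq (i :: l) -> (forall j, j \in i :: l -> D j) ->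
  measurable U -> measurable V ->
  P (family_sum l @^-1` U `&` Y i @^-1` V) =
  (P (family_sum l @^-1` U) * P (Y i @^-1` V))%E.
Proof.
move=> ul Dl mU mV; apply: (sigma_cylinder_indep ul) => //.
apply: (@measurable_preim _ (g_sigma_algebraType (cylinder l))) => //.
by apply: sigma_cylinder_measurable_sum => //; case/andP: ul.
Qed.

(** Here [k] is one of the summands, so the sum and [Y k] are dependent, but both are measurable for
    the sigma-algebra of [l]. It serves to keep the event on [X 1] while a fresh step is added. *)
Lemma family_sum_pair_indep (l : seq I) k i (A U V : set R) :
  uniq (i :: l) -> (forall j, j \in i :: l -> D j) -> k \in l ->
  measurable A -> measurable U -> measurable V ->
  P (family_sum l @^-1` U `&` Y k @^-1` A `&` Y i @^-1` V) =
  (P (family_sum l @^-1` U `&` Y k @^-1` A) * P (Y i @^-1` V))%E.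
Proof.
move=> ul Dl kl mA mU mV; apply: (sigma_cylinder_indep ul) => //.
have ul' : uniq l by case/andP: ul.
apply: (@measurableI _ (g_sigma_algebraType (cylinder l))).
  apply: (@measurable_preim _ (g_sigma_algebraType (cylinder l))) => //.
  exact: sigma_cylinder_measurable_sum.
apply: (@measurable_preim _ (g_sigma_algebraType (cylinder l))) => //.
exact: sigma_cylinder_measurable_fun.
Qed.

Lemma measurable_family_sum (l : seq I) : (forall j, j \in l -> D j) ->
  measurable_fun setT (family_sum l).
Proof.
elim: l => [|j l IH] Dl; rewrite /family_sum.
  by under eq_fun do rewrite big_nil; exact: measurable_cst.
under eq_fun do rewrite big_cons.
apply: measurable_funD.
  by apply/mY/Dl; rewrite mem_head.
by apply: IH => x xl; apply: Dl; rewrite inE xl orbT.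
Qed.

(* Raising one summand from below [s] into ]s, r] keeps the sum below [x + r].
   Counting such moves: when the sum is at most [x], at least [size l - M]
   summands can be raised, and at most [M] of them can be lowered afterwards. *)
Lemma switching (l : seq I) (s r x g M : R) : M = (`|x| + r) / s -> uniq l ->
  (forall j, j \in l -> D j) -> (forall j t, j \in l -> 0 <= Y j t) ->
  0 < s -> 0 <= r -> 0 <= g ->
  (forall j, j \in l -> fine (P (Y j @^-1` `]s, r]%classic)) = g) ->
  g * ((size l)%:R - M) * fine (P [set t | family_sum l t <= x]) <=
  M * fine (P [set t | family_sum l t <= x + r]).
Proof.
move=> ME ul Dl Y0 s0 r0 g0 gE.
have M0 : 0 <= M by rewrite ME divr_ge0 ?addr_ge0// ltW.
have mF c l' : {subset l' <= l} -> measurable [set t | family_sum l' t <= c].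
  by move=> l'l; apply/measurable_le/measurable_family_sum => j /l'l /Dl.
pose U j := Y j @^-1` `]s, r]%classic; pose V j := Y j @^-1` `]-oo, s]%classic.
have mU j : j \in l -> measurable (U j).
  by move=> jl; apply: measurable_preim => //; exact/mY/Dl.
have mV j : j \in l -> measurable (V j).
  by move=> jl; apply: measurable_preim => //; exact/mY/Dl.
(* Each summand in [U j] contributes at least [s] to a sum of nonnegative terms, so at most
   [(x + r) / s <= M] of them are there. *)
have up : \sum_(j <- l) fine (P (U j `&` [set t | family_sum l t <= x + r])) <=
    M * fine (P [set t | family_sum l t <= x + r]).
  apply: sum_pr_le => // [|t Et]; first exact: mF.
  rewrite -(ler_pM2r s0) ME divfK ?gt_eqF// (@le_trans _ _ (x + r))//; last first.
    by rewrite lerD2r ler_norm.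
  apply: le_trans Et; rewrite mulr_suml /family_sum big_seq [leRHS]big_seq.
  apply: ler_sum => j jl; rewrite indicE.
  case: (boolP (t \in U j)) => [|_]; last by rewrite mul0r Y0.
  by rewrite inE /U /= in_itv/= mul1r => /andP[/ltW].
(* Pointwise, [s - Y j t] is at most [s] times the indicator of [V j]; summing over [l] bounds the
   count from below. *)
have down : ((size l)%:R - M) * fine (P [set t | family_sum l t <= x]) <=
    \sum_(j <- l) fine (P (V j `&` [set t | family_sum l t <= x])).
  apply: sum_pr_ge => // [|t Et]; first exact: mF.
  rewrite -(ler_pM2r s0) ME mulrBl divfK ?gt_eqF//.
  apply: (@le_trans _ _ ((size l)%:R * s - family_sum l t)).
    rewrite lerD2l lerN2 (le_trans Et)// (le_trans (ler_norm _))//.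
    by rewrite lerDl.
  rewrite mulr_suml /family_sum -sum1_size natr_sum mulr_suml -sumrB.
  rewrite big_seq [leRHS]big_seq; apply: ler_sum => j jl; rewrite indicE mul1r.
  case: (boolP (t \in V j)) => [_|]; first by rewrite mul1r gerBl Y0.
  rewrite notin_setE /V /= in_itv/= mul0r subr_le0 => /negP; rewrite -ltNge.
  exact: ltW.
apply: le_trans up; rewrite -mulrA.
apply: le_trans (ler_wpM2l g0 down) _; rewrite mulr_sumr.
rewrite big_seq [leRHS]big_seq; apply: ler_sum => j jl.
(* It remains to compare term by term. Both events are related to [W], where the sum without [j] is
   at most [x]: the event with [V j] lies in [W], and [W] together with the independent event [U j]
   keeps the whole sum below [x + r]. *)
have perm : perm_eq l (j :: rem j l) by exact: perm_to_rem.
have ujl : uniq (j :: rem j l) by rewrite -(perm_uniq perm).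
have sub : {subset rem j l <= l} by move=> i; exact: mem_rem.
have split_sum t : family_sum l t = Y j t + family_sum (rem j l) t.
  by rewrite /family_sum (perm_big _ perm)/= big_cons.
pose W := [set t | family_sum (rem j l) t <= x].
have mW : measurable W by exact: mF.
have WE : W = family_sum (rem j l) @^-1` `]-oo, x]%classic.
  by apply/seteqP; split => t /=; rewrite in_itv.
apply: (@le_trans _ _ (g * fine (P W))).
  rewrite ler_wpM2l//; apply: le_pr => //.
    by apply: measurableI; [exact: mV|exact: mF].
  move=> t [_ /=]; rewrite split_sum; apply: le_trans.
  by rewrite lerDr Y0.
have <- : fine (P (W `&` U j)) = g * fine (P W).
  rewrite WE (family_sum_indep ujl)//; last first.
    by move=> i; rewrite inE => /predU1P[->|/sub]; exact: Dl.
  by rewrite -WE fineM ?fin_num_measure//; [rewrite gE// mulrC|exact: mU].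
apply: le_pr; [exact: measurableI (mU _ jl)| |].
  by apply: measurableI; [exact: mU|exact: mF].
move=> t [/= Wt Ut]; split=> //=; rewrite split_sum addrC lerD//.
by move: Ut; rewrite /U /= in_itv/= => /andP[].
Qed.

End independence.

(** * Pascal recurrences and ratios of binomial coefficients *)

Section binomial_asymptotics.
Context (R : realType).

Lemma cvg_bin_succ_ratio i :
  ('C(n, i)%:R / 'C(n, i.+1)%:R : R) @[n --> \oo] --> (0 : R).
Proof.
have h0 : (i.+1%:R * harmonic n : R) @[n --> \oo] --> (0 : R).
  by rewrite -(mulr0 (i.+1%:R : R)); apply: cvgMl_tmp; exact: (@cvg_harmonic R).
(* The ratio is [i.+1 / (n - i)]; shifting [n] by [i.+1] turns it into exactly [i.+1 / n.+1]. *)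
rewrite -(@cvg_shiftn i.+1 R _ (nbhs (0 : R))).
apply: cvg_trans h0.
  apply: near_eq_cvg; apply: nearW => n /=.
  have b0 : ('C(n + i.+1, i.+1)%:R : R) != 0.
    by rewrite pnatr_eq0 -lt0n bin_gt0 leq_addl.
  have n0 : (n.+1%:R : R) != 0 by rewrite pnatr_eq0.
  apply: (mulIf b0); rewrite divfK//; apply: (mulIf n0).
  rewrite mulrAC divfK// -!natrM; congr (_%:R).
  by rewrite mul_bin_left addnS subSn ?leq_addl// addnK mulnC.
Qed.

Lemma cvg_bin_ratio i j :
  ('C(n, i)%:R / 'C(n, i + j)%:R : R) @[n --> \oo] --> ((j == 0)%:R : R).
Proof.
elim: j => [|j IH].
  rewrite addn0; apply: cvg_near_cst; apply: filterS (nbhs_infty_ge i) => n /= ni.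
  by rewrite divff// pnatr_eq0 -lt0n bin_gt0.
have -> : ((j.+1 == 0)%:R : R) = (j == 0)%:R * 0 by rewrite mulr0.
apply: (@cvg_trans _ (('C(n, i)%:R / 'C(n, i + j)%:R *
    ('C(n, i + j)%:R / 'C(n, (i + j).+1)%:R) : R) @[n --> \oo])); last first.
  by apply: cvgM => //; exact: cvg_bin_succ_ratio.
apply: near_eq_cvg; near=> n; rewrite addnS mulrA divfK//.
by rewrite pnatr_eq0 -lt0n bin_gt0; near: n; exact: nbhs_infty_ge.
Unshelve. all: by end_near.
Qed.

(** Induction on [n] with Pascal's rule. The sum may stop at [K] for every [k], because the terms
    beyond involve [c 0] above [K]. *)
Lemma pascal_expansion (c : nat -> nat -> R) (K : nat) :
  (forall n k, c n.+1 k = c n k + c n k.+1) ->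
  (forall k, (K < k)%N -> c 0 k = 0) ->
  forall n k, c n k = \sum_(i < K.+1) 'C(n, i)%:R * c 0 (k + i)%N.
Proof.
move=> rec c0; elim=> [|n IH] k.
  rewrite big_ord_recl/= bin0 mul1r addn0 big1 ?addr0// => i _.
  by rewrite bin0n mul0r.
rewrite rec (IH k) (IH k.+1) [in X in X + _ = _]big_ord_recl/=.
rewrite [in X in _ + X = _]big_ord_recr/= [in RHS]big_ord_recl/= !bin0.
rewrite addSn (c0 (k + K).+1) ?ltnS ?leq_addl// mulr0 addr0 -addrA.
congr (_ + _); rewrite -big_split/=; apply: eq_bigr => i _.
by rewrite /bump /= !add1n binS natrD mulrDl addnS.
Qed.

(** Multiplying by [(p / q) ^+ k / q ^+ n] turns the weighted recurrence into Pascal's. After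
    division by ['C(n, K)] only the top term [i = K] of the expansion survives, and the normalising
    factors cancel in the quotient. *)
Lemma cvg_pascal_ratio (a b : nat -> nat -> R) (q p : R) (K : nat) :
  0 < q -> 0 < p ->
  (forall n k, a n.+1 k = q * a n k + p * a n k.+1) ->
  (forall n k, b n.+1 k = q * b n k + p * b n k.+1) ->
  (forall k, (K < k)%N -> a 0 k = 0) -> (forall k, (K < k)%N -> b 0 k = 0) ->
  b 0 K != 0 ->
  a n 0 / b n 0 @[n --> \oo] --> a 0 K / b 0 K.
Proof.
move=> q0 p0 reca recb a0 b0 bK.
pose r := p / q; have r0 : r != 0 by rewrite mulf_neq0 ?invr_neq0 ?gt_eqF.
have qn0 n : q ^+ n != 0 by rewrite expf_neq0// gt_eqF.
pose nrm (e : nat -> nat -> R) n k := e n k / q ^+ n * r ^+ k.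
have nrm_rec e : (forall n k, e n.+1 k = q * e n k + p * e n k.+1) ->
    forall n k, nrm e n.+1 k = nrm e n k + nrm e n k.+1.
  move=> rec n k; rewrite /nrm rec /r !exprS; field.
  by rewrite qn0 gt_eqF.
have lim e : (forall n k, e n.+1 k = q * e n k + p * e n k.+1) ->
    (forall k, (K < k)%N -> e 0 k = 0) ->
    nrm e n 0 / 'C(n, K)%:R @[n --> \oo] --> nrm e 0 K.
  move=> rec e0; have ne0 k : (K < k)%N -> nrm e 0 k = 0.
    by move=> Kk; rewrite /nrm e0// !mul0r.
  have -> : (fun n => nrm e n 0 / 'C(n, K)%:R) = fun n =>
      \sum_(i < K.+1) 'C(n, i)%:R / 'C(n, i + (K - i))%:R * nrm e 0 i.
    apply/funext => n; rewrite (pascal_expansion (nrm_rec _ rec) ne0).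
    rewrite mulr_suml; apply: eq_bigr => i _.
    by rewrite add0n subnKC 1?mulrAC// -ltnS.
  have -> : nrm e 0 K = \sum_(i < K.+1) ((K - i)%N == 0)%:R * nrm e 0 i.
    rewrite big_ord_recr/= subnn eqxx mul1r big1 ?add0r// => i _.
    by rewrite subn_eq0 leqNgt ltn_ord mul0r.
  apply: cvg_big => [|i _]; first exact: add_continuous.
  by apply: cvgMr_tmp; exact: cvg_bin_ratio.
have -> : a 0 K / b 0 K = nrm a 0 K / nrm b 0 K.
  by rewrite /nrm expr0 !divr1 -mulf_div divff ?mulr1// expf_neq0.
apply: (@cvg_trans _ ((nrm a n 0 / 'C(n, K)%:R) / (nrm b n 0 / 'C(n, K)%:R)
    @[n --> \oo])); last first.
  apply: cvgM; first exact: lim.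
  apply: cvgV; last exact: lim.
  by rewrite /nrm expr0 divr1 mulf_neq0 ?expf_neq0.
apply: near_eq_cvg; apply: filterS (nbhs_infty_ge K) => n /= Kn.
have C0 : ('C(n, K)%:R : R) != 0 by rewrite pnatr_eq0 -lt0n bin_gt0.
rewrite -mulf_div divff ?invr_neq0// mulr1 /nrm expr0 !mulr1.
by rewrite -mulf_div divff ?invr_neq0// mulr1.
Qed.
End binomial_asymptotics.

(** * Events of positive probability and the essential lower bound *)

Section positive_probability.
Context d (T : measurableType d) (R : realType) (P : probability T R).

Lemma gt0_bigcup (A : set T) (F : (set T)^nat) : measurable A ->
  (forall n, measurable (F n)) -> A `<=` \bigcup_n F n ->
  (0 < P A)%E -> exists n, (0 < P (F n))%E.
Proof.
move=> mA mF AF A0; apply: contrapT => F0; move: A0; apply/negP.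
rewrite -leNgt; have : P.-negligible A.
  apply: (negligibleS AF); apply: negligible_bigcup => n.
  apply/negligibleP => //; apply/eqP; rewrite eq_le measure_ge0 andbT leNgt.
  by apply/negP => Fn0; apply: F0; exists n.
by move/negligibleP => ->.
Qed.

Lemma ess_lower_gt0 (Z : T -> R) (e : R) : measurable_fun setT Z -> 0 < e ->
  (0 < P [set t | (Z t <= ess_lower P Z + e)%R])%E.
Proof.
move=> mZ e0; rewrite /ess_lower; set S := [set x : R | _].
(* Nonemptiness: the events [Z t <= n%:R] cover the space, so one of them has positive
   probability. *)
have hS : has_inf S.
  split; last by exists 0 => x [].
  have [||||n Zn] := @gt0_bigcup setT (fun n => [set t | Z t <= n%:R]) => //.
  - by move=> n; exact: measurable_le.
  - move=> t _; exists (Num.bound `|Z t|) => //=.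
    by rewrite (le_trans (ler_norm _))// ltW// archi_boundP.
  - by rewrite probability_setT.
  - by exists n%:R; split.
have [x [x0 Px] xe] := inf_adherent e0 hS.
apply: (lt_le_trans Px); rewrite le_measure ?inE//; try exact: measurable_le.
by move=> t /= /le_trans; apply; exact: ltW.
Qed.

End positive_probability.

(** * The conditioned walk *)

Section conditioned_walk.
Context d (T : measurableType d) (R : realType) (P : probability T R).
Context (X Xf : nat -> T -> R) (L : R).
Hypothesis hXm : forall k, (1 <= k)%N -> measurable_fun setT (X k).
Hypothesis hXfm : forall k, (2 <= k)%N -> measurable_fun setT (Xf k).
Hypothesis hXnn : forall k t, (1 <= k)%N -> 0 <= X k t.

(** Both sequences are merged into one family, so that sums mixing steps [X] and [Xf] fall under the
    independence lemmas. *)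
Let Y (i : nat + nat) := match i with inl k => X k | inr k => Xf k end.
Let D := [set i : nat + nat | match i with
                              | inl k => (1 <= k)%N
                              | inr k => (2 <= k)%N end].
Hypothesis hind : mutually_independent P D Y.
Hypothesis hid : forall k (U : set R), (2 <= k)%N -> measurable U ->
  P (X k @^-1` U) = P (X 2 @^-1` U).
Hypothesis hp : (0 < P [set t | (0 < X 2 t)%R])%E.
Hypothesis hXf : forall k (U : set R), (2 <= k)%N -> measurable U ->
  fine (P (Xf k @^-1` U)) = cprob P (X k @^-1` U) [set t | 0 < X k t].
Hypothesis hI2 : ess_lower P (X 2) = 0.
Hypothesis hL2 : (0 < P [set t | (X 1 t + Xf 2 t <= L)%R])%E.

(** * Law of a step and the recurrence for mixed sums *)

Let q := fine (P (X 2 @^-1` [set 0])).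
Let p := fine (P [set t | 0 < X 2 t]).

Let mY i : D i -> measurable_fun setT (Y i).
Proof. by case: i => k Dk; [exact: hXm|exact: hXfm]. Qed.

Let p_gt0 : 0 < p.
Proof. by rewrite /p pr_gt0//; apply: measurable_gt; exact: hXm. Qed.

Let q_ge0 : 0 <= q. Proof. exact: pr_ge0. Qed.

Let mXf k V : (2 <= k)%N -> measurable V -> measurable (Xf k @^-1` V).
Proof. by move=> k2; apply: measurable_preim; exact: hXfm. Qed.

Let mX k V : (1 <= k)%N -> measurable V -> measurable (X k @^-1` V).
Proof. by move=> k2; apply: measurable_preim; exact: hXm. Qed.

Lemma frak_law k V : (2 <= k)%N -> measurable V ->
  p * fine (P (Xf k @^-1` V)) = fine (P (X 2 @^-1` (V `&` `]0, +oo[%classic))).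
Proof.
move=> k2 mV; rewrite hXf// /cprob.
have pos : [set t | 0 < X k t] = X k @^-1` `]0, +oo[%classic.
  by apply/seteqP; split => t /=; rewrite in_itv/= andbT.
have -> : P [set t | 0 < X k t] = P [set t | 0 < X 2 t].
  rewrite pos hid//; congr (P _).
  by apply/seteqP; split => t /=; rewrite in_itv/= andbT.
rewrite mulrC divfK; last by rewrite gt_eqF.
by rewrite pos -preimage_setI hid//; exact: measurableI.
Qed.

(** By nonnegativity a step is [0] or positive; [frak_law] identifies the positive part. The
    probability of the preimage under [cst 0] is the Dirac mass at [0], in the shape that
    [joint_law_mixture] expects. *)
Lemma step_law j k V : (2 <= j)%N -> (2 <= k)%N -> measurable V ->
  P (X j @^-1` V) = (q%:E * P (cst (0%R : R) @^-1` V : set T) +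
                     p%:E * P (Xf k @^-1` V))%E.
Proof.
move=> j2 k2 mV; rewrite hid// [in RHS](prE P (mXf k2 mV)) -EFinM frak_law//.
have m0 : measurable (V `&` [set 0 : R]) by exact: measurableI.
have mp : measurable (V `&` `]0, +oo[%classic : set R) by exact: measurableI.
have -> : X 2 @^-1` V =
    (X 2 @^-1` (V `&` [set 0])) `|` (X 2 @^-1` (V `&` `]0, +oo[%classic)).
  rewrite -preimage_setU; apply/seteqP; split => t /=; last by case => -[].
  rewrite in_itv/= andbT => Vt.
  have := hXnn t (isT : (1 <= 2)%N); rewrite le_eqVlt => /predU1P[x0|x0].
    by left; split.
  by right; split.
rewrite measureU; [|exact: mX|exact: mX|]; last first.
  rewrite -preimage_setI; apply/seteqP; split => t //= -[[_ ->]] [_].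
  by rewrite in_itv/= ltxx.
rewrite -[X in _ = (_ + X)%E]prE; last exact: mX.
congr (_ + _)%E.
have [V0|V0] := pselect (V 0).
  rewrite (_ : cst _ @^-1` V = setT); last by apply/seteqP; split.
  rewrite probability_setT mule1 /q -prE; last exact: mX.
  by congr (P (X 2 @^-1` _)); apply/seteqP; split => x /=; [case|move=> ->].
rewrite (_ : cst _ @^-1` V = set0); last by apply/seteqP; split.
rewrite measure0 mule0 (_ : _ `&` _ = set0) ?preimage_set0 ?measure0//.
by apply/seteqP; split => x //= -[Vx x0]; apply: V0; rewrite -x0.
Qed.

Let idx n k : seq (nat + nat) :=
  [seq inl i | i <- index_iota 1 n.+1] ++ [seq inr i | i <- index_iota 2 k.+2].

Let S n k t := partial_sum X n t + frak_sum Xf k t.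

Let idxE n k : family_sum Y (idx n k) = S n k.
Proof. by apply/funext => t; rewrite /family_sum big_cat/= !big_map. Qed.

Let idx_inl n k i : (inl i \in idx n k) = (1 <= i <= n)%N.
Proof.
rewrite mem_cat mem_map; last by move=> ? ? [].
rewrite mem_index_iota ltnS orbC; case: mapP => //= -[x _] //.
Qed.

Let idx_inr n k i : (inr i \in idx n k) = (2 <= i <= k.+1)%N.
Proof.
rewrite mem_cat orbC mem_map; last by move=> ? ? [].
rewrite mem_index_iota ltnS orbC; case: mapP => //= -[x _] //.
Qed.

Let idx_uniq n k : uniq (idx n k).
Proof.
rewrite cat_uniq !map_inj_uniq ?iota_uniq; try by move=> ? ? [].
rewrite andbT /=; apply/hasPn => x /mapP[i _ ->].
by apply/mapP => -[].
Qed.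

Let idx_dom n k i : i \in idx n k -> D i.
Proof. by case: i => i; rewrite ?idx_inl ?idx_inr => /andP[]. Qed.

Let mS n k : measurable_fun setT (S n k).
Proof.
rewrite -idxE; apply: (@measurable_family_sum _ _ _ _ D) => //.
exact: idx_dom.
Qed.

Let SX n k t : S n.+1 k t = S n k t + X n.+1 t.
Proof. by rewrite /S /partial_sum big_nat_recr//= addrAC. Qed.

Let SXf n k t : S n k.+1 t = S n k t + Xf k.+2 t.
Proof. by rewrite /S /frak_sum big_nat_recr//= addrA. Qed.

Let S10 t : S 1 0 t = X 1 t.
Proof. by rewrite /S /partial_sum /frak_sum big_nat1 big_geq// addr0. Qed.

(** The last step [X n.+2] is replaced by [0] or by the fresh [Xf k.+2], with weights [q] and [p].
    The counts start at [S n.+1] because [X 1] is always among the summands and is never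
    replaced. *)
Lemma walk_recurrence (A : set R) n k : measurable A ->
  fine (P ([set t | S n.+2 k t <= L] `&` X 1 @^-1` A)) =
  q * fine (P ([set t | S n.+1 k t <= L] `&` X 1 @^-1` A)) +
  p * fine (P ([set t | S n.+1 k.+1 t <= L] `&` X 1 @^-1` A)).
Proof.
move=> mA; have mB : measurable (X 1 @^-1` A) by exact: mX.
have mSL m l : measurable ([set t | S m l t <= L] `&` X 1 @^-1` A).
  by apply: measurableI => //; exact: measurable_le.
apply: EFin_inj; rewrite EFinD !EFinM -!(prE P (mSL _ _)).
have -> : S n.+2 k = fun t => S n.+1 k t + X n.+2 t by exact/funext/SX.
have -> : S n.+1 k.+1 = fun t => S n.+1 k t + Xf k.+2 t.
  exact/funext/SXf.
suff rect U V : measurable U -> measurable V ->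
    P (S n.+1 k @^-1` U `&` X n.+2 @^-1` V `&` X 1 @^-1` A) =
    (q%:E * P (S n.+1 k @^-1` U `&` cst (0%R : R) @^-1` V `&` X 1 @^-1` A) +
     p%:E * P (S n.+1 k @^-1` U `&` Xf k.+2 @^-1` V `&` X 1 @^-1` A))%E.
  exact: (@joint_law_mixture _ _ _ P _ _ _ _
    (NngNum q_ge0) (NngNum (ltW p_gt0)) mB (mS _ _)
    (@hXm n.+2 isT) (@hXfm k.+2 isT) rect L).
move=> mU mV.
(* Any variable outside the current sum is independent of the pair formed by that sum and [X 1];
   this applies to both [X n.+2] and [Xf k.+2]. *)
have indep i : D i -> i \notin idx n.+1 k ->
    P (S n.+1 k @^-1` U `&` Y i @^-1` V `&` X 1 @^-1` A) =
    (P (S n.+1 k @^-1` U `&` X 1 @^-1` A) * P (Y i @^-1` V))%E.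
  move=> Di il; rewrite setIAC -idxE.
  apply: (family_sum_pair_indep mY hind (k := inl 1)) => //.
  - by rewrite cons_uniq il idx_uniq.
  - by move=> j; rewrite inE => /predU1P[->//|]; exact: idx_dom.
rewrite (indep (inl n.+2)) ?idx_inl ?ltnn ?andbF//.
rewrite (indep (inr k.+2)) ?idx_inr ?ltnn ?andbF//=.
rewrite (@step_law n.+2 k.+2)// ge0_muleDr ?mule_ge0 ?lee_fin ?(ltW p_gt0)//.
rewrite [X in (X + _)%E]muleCA [X in (_ + X)%E]muleCA; congr (_ * _ + _)%E.
have [V0|V0] := pselect (V 0).
  rewrite (_ : cst _ @^-1` V = setT); last by apply/seteqP; split.
  by rewrite setIT probability_setT mule1.
rewrite (_ : cst _ @^-1` V = set0); last by apply/seteqP; split.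
by rewrite setI0 set0I measure0 mule0.
Qed.

(** * Mass near zero and the case of finite [K*] *)

Let SE1 k t : S 1 k t = X 1 t + frak_sum Xf k t.
Proof. by rewrite /S /partial_sum big_nat1. Qed.

Let Sn0 n t : S n 0 t = partial_sum X n t.
Proof. by rewrite /S /frak_sum big_geq// addr0. Qed.

Lemma frak_le_gt0 k e : (2 <= k)%N ->
  (0 < P [set t | (Xf k t <= e)%R])%E = (0 < P (X 2 @^-1` `]0%R, e]%classic))%E.
Proof.
move=> k2; have mle : measurable [set t | Xf k t <= e].
  by apply: measurable_le; exact: hXfm.
rewrite -!pr_gt0//; last exact: mX.
have -> : [set t | Xf k t <= e] = Xf k @^-1` `]-oo, e]%classic.
  by apply/seteqP; split => t /=; rewrite in_itv.
rewrite -(pmulr_rgt0 _ p_gt0) frak_law//; congr (0 < fine (P (X 2 @^-1` _))).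
apply/seteqP; split => x /=; rewrite !in_itv/= andbT; last by move=> /andP[].
by case=> xe x0; apply/andP.
Qed.

Lemma frak_le0 k : (2 <= k)%N -> P [set t | (Xf k t <= 0)%R] = 0%E.
Proof.
move=> k2; apply/eqP; rewrite eq_le measure_ge0 andbT leNgt frak_le_gt0//.
by rewrite set_itv_ge ?preimage_set0 ?measure0 ?ltxx// -leNgt.
Qed.

(** Since [Xf 2] is almost surely positive, [X 1 + Xf 2 <= L] leaves a strict gap below [L]. The set
    [F 0] collects the null exception and [F m.+1] the gaps of size at least [1 / m.+1]. *)
Lemma first_step_lt : exists2 e : R, 0 < e & (0 < P [set t | (X 1 t <= L - e)%R])%E.
Proof.
have mX1 : measurable_fun setT (X 1) by exact: hXm.
have mF2 : measurable_fun setT (Xf 2) by exact: hXfm.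
pose F n := if n is m.+1 then [set t | X 1 t <= L - m.+1%:R^-1]
            else [set t | Xf 2 t <= 0].
have [|||[|n] Fn] := @gt0_bigcup _ _ _ P
    [set t | X 1 t + Xf 2 t <= L] F _ _ _ hL2.
- exact/measurable_le/measurable_funD.
- by case=> [|n]; exact: measurable_le.
- move=> t /= Lt; have [F0|F0] := leP (Xf 2 t) 0; first by exists 0.
  exists (Num.bound (Xf 2 t)^-1).+1 => //=.
  rewrite lerBrDr (le_trans _ Lt)// lerD2l.
  rewrite -[leRHS]invrK lef_pV2 ?posrE ?invr_gt0// (@le_trans _ _
    (Num.bound (Xf 2 t)^-1)%:R)//; last by rewrite ler_nat.
  by rewrite ltW// archi_boundP// invr_ge0 ltW.
- by move: Fn; rewrite /F frak_le0// ltxx.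
- by exists n.+1%:R^-1; rewrite ?invr_gt0.
Qed.

(** The slack [e] left by [X 1] is shared among [k] independent summands, each at most [e / k.+1]
    with positive probability. *)
Lemma spread_frak_sum_gt0 :
  (forall e : R, 0 < e -> (0 < P (X 2 @^-1` `]0%R, e]%classic))%E) ->
  forall k, (0 < P [set t | (S 1 k t <= L)%R])%E.
Proof.
move=> spread k; have [e e0 X1e] := first_step_lt.
suff H h : 0 < h -> forall j, (0 < P [set t | (S 1 j t <= L - e + h *+ j)%R])%E.
  have := H (e / k.+1%:R) (divr_gt0 e0 (ltr0Sn _ _)) k.
  move=> /lt_le_trans; apply; rewrite le_measure ?inE//; try exact: measurable_le.
  move=> t /= /le_trans; apply; rewrite -addrA gerDl addrC subr_le0.
  rewrite -[_ *+ k]mulr_natr -mulrA ger_pMr// mulrC ler_pdivrMr ?ltr0Sn//.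
  by rewrite mul1r ler_nat.
move=> h0; elim=> [|j IH].
  rewrite (_ : S 1 0 = X 1) ?addr0//; exact/funext/S10.
pose W := [set t | S 1 j t <= L - e + h *+ j].
have WE : W = family_sum Y (idx 1 j) @^-1` `]-oo, L - e + h *+ j]%classic.
  by rewrite idxE; apply/seteqP; split => t /=; rewrite in_itv.
have mW : measurable W by exact: measurable_le.
have mh : measurable [set t | Xf j.+2 t <= h].
  by apply: measurable_le; exact: hXfm.
apply: (@lt_le_trans _ _ (P (W `&` [set t | Xf j.+2 t <= h]))); last first.
  rewrite le_measure ?inE//; [exact: measurableI|exact: measurable_le|].
  by move=> t [/= Wt ht]; rewrite SXf mulrSr addrA lerD.
have -> : [set t | Xf j.+2 t <= h] = Y (inr j.+2) @^-1` `]-oo, h]%classic.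
  by apply/seteqP; split => t /=; rewrite in_itv.
rewrite WE (family_sum_indep mY hind)//.
- rewrite -WE mule_gt0// (_ : _ @^-1` _ = [set t | Xf j.+2 t <= h]).
    by rewrite frak_le_gt0// spread.
  by apply/seteqP; split => t /=; rewrite in_itv.
- by rewrite cons_uniq idx_uniq idx_inr ltnn andbF.
- by move=> i; rewrite inE => /predU1P[->//|]; exact: idx_dom.
Qed.

(** Without an atom at [0], the assumption that the essential lower bound of [X 2] is [0] would put
    mass on every []0, e]]. Then sums with arbitrarily many terms [Xf] would stay below [L] with
    positive probability. *)
Lemma atom_gt0 (K : nat) :
  (forall k, (K < k)%N -> ~ (0 < P [set t | (S 1 k t <= L)%R])%E) -> 0 < q.
Proof.
move=> SK; rewrite lt0r q_ge0 andbT; apply/eqP => q0.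
apply: (SK K.+1 (ltnSn K)); apply: spread_frak_sum_gt0 => e e0.
have := @ess_lower_gt0 _ _ _ P (X 2) e (hXm (isT : (1 <= 2)%N)) e0.
rewrite hI2 add0r => /lt_le_trans; apply.
have -> : [set t | X 2 t <= e] =
    X 2 @^-1` [set 0] `|` X 2 @^-1` `]0, e]%classic.
  apply/seteqP; split => t /=; rewrite in_itv/=.
    move=> xe; have := hXnn t (isT : (1 <= 2)%N); rewrite [0 <= _]le_eqVlt.
    by case/predU1P => x0; [left|right; rewrite x0].
  by case=> [->|/andP[]//]; exact: ltW.
have m0 : measurable (X 2 @^-1` [set 0]) by exact: mX.
have me : measurable (X 2 @^-1` `]0, e]%classic) by exact: mX.
have P0 : P (X 2 @^-1` [set 0]) = 0%E by rewrite (prE P m0) -/q q0.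
by apply: (le_trans (measureU2 P m0 me)); rewrite [X in (X + _)%E]P0 add0e.
Qed.

Lemma finite_regime (K : nat) (A : set R) : measurable A ->
  (0 < P [set t | (X 1 t + frak_sum Xf K t <= L)%R])%E ->
  (forall k, (K < k)%N -> ~ (0 < P [set t | (X 1 t + frak_sum Xf k t <= L)%R])%E) ->
  cprob P (X 1 @^-1` A) [set t | partial_sum X n t <= L] @[n --> \oo] -->
  cprob P (X 1 @^-1` A) [set t | X 1 t + frak_sum Xf K t <= L].
Proof.
have KE k : [set t | X 1 t + frak_sum Xf k t <= L] = [set t | S 1 k t <= L].
  have -> // : S 1 k = fun t => X 1 t + frak_sum Xf k t by exact/funext/SE1.
move=> mA + SK'; rewrite KE => PK.
have SK k : (K < k)%N -> ~ (0 < P [set t | (S 1 k t <= L)%R])%E.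
  by rewrite -KE; exact: SK'.
have q0 := atom_gt0 SK.
(* The array of the recurrence: numerators are [a A], denominators [a setT]. Its index [n] counts
   the steps after [X 1], hence the shift by one in the limit below. *)
pose a B n k := fine (P ([set t | S n.+1 k t <= L] `&` X 1 @^-1` B)).
have mSL m l : measurable [set t | S m l t <= L] by exact: measurable_le.
have a0 B k : measurable B -> (K < k)%N -> a B 0 k = 0.
  move=> mB Kk; apply/eqP; rewrite eq_le pr_ge0 andbT.
  apply: (@le_trans _ _ (fine (P [set t | S 1 k t <= L]))).
    by apply: le_pr => //; apply: measurableI => //; exact: mX.
  by rewrite leNgt pr_gt0//; apply/negP; exact: SK.
have aT n k : a setT n k = fine (P [set t | S n.+1 k t <= L]).
  by rewrite /a preimage_setT setIT.
have cE m k : cprob P (X 1 @^-1` A) [set t | S m.+1 k t <= L] =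
    a A m k / a setT m k.
  by rewrite aT /cprob setIC.
rewrite cE -(@cvg_shiftn 1 R _ (nbhs (a A 0 K / a setT 0 K))).
apply: (@cvg_trans _ (a A n 0 / a setT n 0 @[n --> \oo])); last first.
  apply: (cvg_pascal_ratio q0 p_gt0).
  - by move=> n k; exact: walk_recurrence.
  - by move=> n k; exact: walk_recurrence.
  - by move=> k; exact: a0.
  - by move=> k; exact: a0.
  - by rewrite aT gt_eqF// pr_gt0.
apply: near_eq_cvg; apply: nearW => n /=; rewrite addn1 -cE.
by congr (cprob P _ _); apply/seteqP; split => t /=; rewrite Sn0.
Qed.

(** * The case of infinite [K*] *)

Lemma infinite_spread :
  (forall M : nat, exists2 k, (M < k)%N &
     (0 < P [set t | (X 1 t + frak_sum Xf k t <= L)%R])%E) ->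
  forall e : R, 0 < e -> (0 < P (X 2 @^-1` `]0%R, e]%classic))%E.
Proof.
move=> Kinf e e0; have [k kb Pk] := Kinf (Num.bound (`|L| / e)).
have ke : L < e *+ k.
  rewrite -mulr_natr -ltr_pdivrMl// mulrC.
  have : `|L| / e < k%:R.
    rewrite (lt_trans (archi_boundP _))// ?ltr_nat//.
    by rewrite divr_ge0// ltW.
  by apply: le_lt_trans; rewrite ler_pM2r ?invr_gt0// ler_norm.
have [|||n] := @gt0_bigcup _ _ _ P _ (fun n => [set t | Xf n.+2 t <= e]) _ _ _ Pk.
- have -> : [set t | X 1 t + frak_sum Xf k t <= L] = [set t | S 1 k t <= L].
    have -> // : S 1 k = fun t => X 1 t + frak_sum Xf k t by exact/funext/SE1.
  exact: measurable_le.
- by move=> n; apply: measurable_le; exact: hXfm.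
- move=> t /= Lt; apply: contrapT => big.
  have {}big i : (2 <= i)%N -> e <= Xf i t.
    case: i => [|[|i]]// _; rewrite leNgt; apply/negP => /ltW Xi.
    by apply: big; exists i.
  move: Lt; apply/negP; rewrite -ltNge (lt_le_trans ke)//.
  apply: (@le_trans _ _ (frak_sum Xf k t)); last by rewrite lerDr hXnn.
  rewrite /frak_sum -[leLHS](_ : \sum_(2 <= i < k.+2) e = _); last first.
    by rewrite sumr_const_nat !subSS subn0.
  by rewrite big_nat [leRHS]big_nat; apply: ler_sum => i /andP[/big].
- by rewrite frak_le_gt0.
Qed.

Let tl n : seq (nat + nat) := [seq inl i | i <- index_iota 2 n.+2].

Let tl_dom n j : j \in tl n -> exists2 i, j = inl i & (2 <= i)%N.
Proof.
by move=> /mapP[i]; rewrite mem_index_iota => /andP[i2 _] ->; exists i.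
Qed.

Let tl_uniq n : uniq (tl n).
Proof. by rewrite map_inj_uniq ?iota_uniq// => ? ? []. Qed.

Let partial_sumE n t : partial_sum X n.+1 t = X 1 t + family_sum Y (tl n) t.
Proof. by rewrite /partial_sum big_ltn// /family_sum big_map. Qed.

(** If [X 1] exceeds [I1 + delta], the other steps sum to at most [x = L - I1 - delta]. If
    [X 1 <= I1 + delta / 2], of positive probability [c], they may reach [x + delta / 2]. Switching
    with [r = delta / 2] makes the first event smaller by a factor of order [1 / n]. *)
Lemma infinite_regime (delta : R) : 0 < delta ->
  (forall e : R, 0 < e -> (0 < P (X 2 @^-1` `]0%R, e]%classic))%E) ->
  cprob P [set t | ess_lower P (X 1) + delta < X 1 t]
    [set t | partial_sum X n t <= L] @[n --> \oo] --> (0 : R).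
Proof.
move=> d0 spread; set I1 := ess_lower P (X 1); pose r := delta / 2.
have r0 : 0 < r by rewrite divr_gt0.
have mX1 : measurable_fun setT (X 1) by exact: hXm.
(* The interval []0, r]] is the union of the []1 / n.+1, r]], so one of these already carries
   mass. *)
have [s s0 gs] : exists2 s : R, 0 < s &
    (0 < P (X 2 @^-1` `]s, r]%classic))%E.
  have [|||n Pn] := @gt0_bigcup _ _ _ P _
      (fun n => X 2 @^-1` `]n.+1%:R^-1, r]%classic) _ _ _ (spread r r0).
  - exact: mX.
  - by move=> n; exact: mX.
  - move=> t /=; rewrite in_itv/= => /andP[x0 xr].
    exists (Num.bound (X 2 t)^-1) => //=; rewrite in_itv/= xr andbT.
    rewrite -[ltRHS]invrK ltf_pV2 ?posrE ?invr_gt0//.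
    rewrite (@lt_trans _ _ (Num.bound (X 2 t)^-1)%:R) ?ltr_nat//.
    by rewrite archi_boundP// invr_ge0 ltW.
  by exists n.+1%:R^-1; rewrite ?invr_gt0.
pose g := fine (P (X 2 @^-1` `]s, r]%classic)).
have g0 : 0 < g by rewrite /g pr_gt0//; exact: mX.
pose c := fine (P [set t | X 1 t <= I1 + r]).
have c0 : 0 < c.
  by rewrite /c pr_gt0 ?ess_lower_gt0//; exact: measurable_le.
pose x := L - I1 - delta; pose M := (`|x| + r) / s.
have M0 : 0 <= M by rewrite divr_ge0 ?addr_ge0// ltW.
have Dtl n j : j \in tl n -> D j.
  by move=> /tl_dom[i -> i2] /=; exact: ltnW.
have mtl n : measurable_fun setT (family_sum Y (tl n)).
  by apply: (@measurable_family_sum _ _ _ _ D) => //; exact: Dtl.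
pose a n := fine (P ([set t | I1 + delta < X 1 t] `&`
  [set t | partial_sum X n.+1 t <= L])).
pose b n := fine (P [set t | partial_sum X n.+1 t <= L]).
have mps n : measurable [set t | partial_sum X n.+1 t <= L].
  rewrite (_ : partial_sum X n.+1 = S n.+1 0); last exact/funext.
  exact: measurable_le.
have aF n : a n <= fine (P [set t | family_sum Y (tl n) t <= x]).
  apply: le_pr; [|exact: measurable_le|].
    by apply: measurableI => //; exact: measurable_gt.
  move=> t /= [X1t]; rewrite partial_sumE /x => Lt.
  rewrite !lerBrDr (le_trans _ Lt)// -addrA addrC lerD2r addrC.
  exact: ltW.
have bF n : c * fine (P [set t | family_sum Y (tl n) t <= x + r]) <= b n.
  pose W := family_sum Y (tl n) @^-1` `]-oo, x + r]%classic.
  have WE : [set t | family_sum Y (tl n) t <= x + r] = W.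
    by rewrite /W; apply/seteqP; split => t /=; rewrite in_itv.
  pose V := Y (inl 1) @^-1` `]-oo, I1 + r]%classic.
  have VE : [set t | X 1 t <= I1 + r] = V.
    by rewrite /V; apply/seteqP; split => t /=; rewrite in_itv.
  have mW : measurable W by exact: measurable_preim.
  have mV : measurable V by exact: measurable_preim.
  have <- : fine (P (W `&` V)) =
      c * fine (P [set t | family_sum Y (tl n) t <= x + r]).
    rewrite (family_sum_indep mY hind)//.
    - by rewrite fineM ?fin_num_measure// WE /c VE mulrC.
    - rewrite cons_uniq tl_uniq andbT; apply/negP => /tl_dom[i [<-]].
      by rewrite ltnn.
    - by move=> j; rewrite inE => /predU1P[->//|]; exact: Dtl.
  apply: le_pr => //; first exact: measurableI.
  rewrite -WE -VE => t [/= Wt Vt]; rewrite partial_sumE (le_trans (lerD Vt Wt))//.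
  by rewrite /x /r; lra.
have sw n : g * (n%:R - M) * fine (P [set t | family_sum Y (tl n) t <= x]) <=
    M * fine (P [set t | family_sum Y (tl n) t <= x + r]).
  have -> : n%:R = (size (tl n))%:R :> R by rewrite size_map size_iota subSS subn1.
  apply: (switching mY hind (s := s)) => //.
  - exact: Dtl.
  - by move=> j t /tl_dom[i -> i2]; exact: hXnn (ltnW i2).
  - exact: ltW.
  - exact: ltW.
  - by move=> j /tl_dom[i -> i2]; rewrite /= hid.
(* The quotient comes from combining [aF], [sw] and [bF]; adding [1] gives positivity at once. *)
pose C := M / (g * c) + 1.
have C0 : 0 < C by rewrite ltr_wpDl// divr_ge0// ltW// mulr_gt0.
have b0 n : 0 <= b n by exact: pr_ge0.
have main n : M <= n%:R -> (n%:R - M) * a n <= C * b n.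
  move=> Mn; apply: (@le_trans _ _ (M / (g * c) * b n)); last first.
    by rewrite ler_wpM2r// lerDl.
  rewrite mulrAC ler_pdivlMr ?mulr_gt0//.
  apply: (@le_trans _ _ (c * (g * (n%:R - M) *
      fine (P [set t | family_sum Y (tl n) t <= x])))).
    rewrite (_ : _ * a n * _ = c * (g * (n%:R - M) * a n)); last by ring.
    rewrite ler_wpM2l ?(ltW c0)// ler_wpM2l// mulr_ge0 ?subr_ge0//.
    exact: ltW.
  apply: (le_trans (ler_wpM2l (ltW c0) (sw n))).
  by rewrite mulrCA ler_wpM2l.
rewrite -(@cvg_shiftn 1 R _ (nbhs (0 : R))).
apply/cvgrPdist_le => e e0.
apply: filterS (nbhs_infty_ger (M + C / e)) => n /= Mn.
rewrite sub0r normrN addn1 /cprob -/(a n) -/(b n).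
rewrite ger0_norm; last by rewrite divr_ge0 ?pr_ge0.
(* If the conditioning event is null, the conditional probability is [0] by convention. *)
have [bn|bn] := eqVneq (b n) 0; first by rewrite bn invr0 mulr0 ltW.
rewrite ler_pdivrMr; last by rewrite lt0r bn b0.
have Ce : C / e <= n%:R - M by rewrite lerBrDl.
have Mn' : M <= n%:R by rewrite (le_trans _ Mn)// lerDl divr_ge0// ltW.
rewrite -(ler_pM2l (divr_gt0 C0 e0)) mulrA divfK ?gt_eqF//.
apply: le_trans (main n Mn').
by rewrite ler_wpM2r// pr_ge0.
Qed.

End conditioned_walk.

(** * The two regimes combined *)

Unset Implicit Arguments.

Theorem theoremA2 (d : measure_display) (T : measurableType d) (R : realType)
  (P : probability T R) (X Xf : nat -> T -> R) (L : R)
  (* measurability *)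
  (hXm : forall k, (1 <= k)%N -> measurable_fun setT (X k))
  (hXfm : forall k, (2 <= k)%N -> measurable_fun setT (Xf k))
  (* X_1, X_2, ... nonnegative *)
  (hXnn : forall k t, (1 <= k)%N -> 0 <= X k t)
  (* (X_k)_{k>=1} and (frakX_k)_{k>=2} jointly mutually independent *)
  (hind : mutually_independent P
            [set i : nat + nat | match i with
                                 | inl k => (1 <= k)%N
                                 | inr k => (2 <= k)%N end]
            (fun i => match i with inl k => X k | inr k => Xf k end))
  (* X_2, X_3, ... identically distributed *)
  (hid : forall k (U : set R), (2 <= k)%N -> measurable U ->
           P (X k @^-1` U) = P (X 2 @^-1` U))
  (* p = P(X_k > 0) in (0,1] *)
  (hp : (0 < P [set t | (0 < X 2 t)%R])%E)
  (* law of frakX_k is the law of X_k conditioned on X_k > 0 *)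
  (hXf : forall k (U : set R), (2 <= k)%N -> measurable U ->
           fine (P (Xf k @^-1` U)) = cprob P (X k @^-1` U) [set t | 0 < X k t])
  (hI2 : ess_lower P (X 2) = 0)
  (hL : 0 < L)
  (hL2 : (0 < P [set t | (X 1 t + Xf 2 t <= L)%R])%E) :
  let Kset := [set k : nat | (1 <= k)%N /\
                 (0 < P [set t | (X 1 t + frak_sum Xf k t <= L)%R])%E] in
  let I1 := ess_lower P (X 1) in
  ((* (1) K* = infinity *)
   (forall M : nat, exists k, Kset k /\ (M < k)%N) ->
   forall delta : R, 0 < delta ->
     cprob P [set t | I1 + delta < X 1 t] [set t | partial_sum X n t <= L]
       @[n --> \oo] --> 0)
  /\
  ((* (2) K* = K < infinity *)
   forall K : nat, Kset K -> (forall k, Kset k -> (k <= K)%N) ->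
   forall delta : R, 0 < delta ->
     cprob P [set t | I1 + delta < X 1 t] [set t | partial_sum X n t <= L]
       @[n --> \oo] -->
     cprob P [set t | I1 + delta < X 1 t] [set t | X 1 t + frak_sum Xf K t <= L]).
Proof.
move=> Kset I1; split => [Kinf|K [_ PK] Kmax] delta d0.
  have spread := infinite_spread (L := L) hXm hXfm hXnn hid hp hXf.
  apply: (infinite_regime L hXm hXfm hXnn hind hid d0 (spread _)) => M.
  by have [k [[_ Pk] Mk]] := Kinf M; exists k.
have AE : [set t | I1 + delta < X 1 t] = X 1 @^-1` `]I1 + delta, +oo[%classic.
  by apply/seteqP; split => t /=; rewrite in_itv/= andbT.
rewrite AE.
apply: (finite_regime hXm hXfm hXnn hind hid hp hXf hI2 hL2) => // k Kk Pk.
(* An index above [K] is at least [1], so positivity of its probability would place it in [Kset],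
   against maximality. *)
by have := Kmax k (conj (leq_ltn_trans (leq0n K) Kk) Pk); rewrite leqNgt Kk.
Qed.
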